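(* Let $\varepsilon\in[0,1]$, let $\mathcal{M}$ be a finite LMC, let some states in $\mathcal{M}$ be labeled with $g$, and let exactly the states that cannot reach a $g$-labeled state be labeled with $f$. Let $s\approx_\varepsilon^b t$, let $R$ be a branching $\varepsilon$-bisimulation with $(s,t)\in R$, and let $N^b$ denote the random variable that counts the number of $R$-equivalence class changes until a $g$- or $f$-labeled state is reached. Then $|\mathrm{Pr}_s(\lozenge g)-\mathrm{Pr}_t(\lozenge g)|\le\varepsilon\cdot\mathbb{E}_s(N^b)$.
   Context: Fix a countable set $AP$ of atomic propositions, with distinct $g,f\in AP$. A labeled Markov chain (LMC) $\mathcal{M}=(S,P,s_{init},l)$ has a countable nonempty state set $S$, a transition function $P\colon S\to Distr(S)$ ($Distr(S)$ is the set of probability distributions on $S$), an initial state $s_{init}\in S$ and a labeling $l\colon S\to 2^{AP}$; it is finite if $S$ is finite. A state $u$ is labeled with $a\in AP$ if $a\in l(u)$. $\mathrm{Pr}_s$ and $\mathbb{E}_s$ are the standard probability measure and expectation on infinite paths starting in $s$. $\mathrm{Pr}_s(\lozenge g)$ is the probability of eventually visiting a $g$-labeled state. For $B,C\subseteq S$, $\mathrm{Pr}_s(B\,\mathsf{U}\,C)$ is the probability that a path from $s$ eventually visits $C$ with all states before the first visit to $C$ lying in $B$ (so it is $1$ if $s\in C$). $A\subseteq S$ is $R$-closed if $u\in A$ and $(u,v)\in R$ imply $v\in A$. An equivalence $R$ with classes $[s]_R$ is a branching $\varepsilon$-bisimulation if for all $(s,t)\in R$ and all $R$-closed $A\subseteq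 S$: $l(s)=l(t)$ and $|\mathrm{Pr}_s([s]_R\,\mathsf{U}\,A)-\mathrm{Pr}_t([t]_R\,\mathsf{U}\,A)|\le\varepsilon$. $s\approx_\varepsilon^b t$ if $(s,t)\in R$ for some branching $\varepsilon$-bisimulation $R$. For a path $s_0s_1s_2\dots$ whose first $g$- or $f$-labeled state is $s_k$, $N^b$ is the number of $i<k$ with $(s_i,s_{i+1})\notin R$. *)

(* Defs.v *)
From HB Require Import structures.
From mathcomp Require Import all_boot all_order all_algebra.
From mathcomp Require Import all_classical all_reals all_analysis.
Set Implicit Arguments.
Unset Strict Implicit.
Unset Printing Implicit Defensive.
Import Order.TTheory GRing.Theory Num.Theory.
Import numFieldNormedType.Exports.
Local Open Scope classical_set_scope.
Local Open Scope ring_scope.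

Record finLMC (R : realType) (AP : countType) := FinLMC {
  state :> finType;
  trans : state -> state -> R;
  trans_ge0 : forall u v, 0 <= trans u v;
  trans_sum1 : forall u, \sum_v trans u v = 1;
  init : state;
  label : state -> set AP }.

Section paths.
Context {R : realType} {AP : countType} (M : finLMC R AP).

Definition lpath := nat -> M.

HB.instance Definition _ := gen_eqMixin lpath.
HB.instance Definition _ := gen_choiceMixin lpath.
HB.instance Definition _ := isPointed.Build lpath (fun=> init M).

Definition cylinder (w : lpath) (n : nat) : set lpath :=
  [set x | forall i, (i <= n)%N -> x i = w i].

Definition cylinders : set (set lpath) :=
  [set C | exists w n, C = cylinder w n].

Definition pathSpace := g_sigma_algebraType cylinders.

Definition is_path_measure (s : M) (mu : probability pathSpace R) : Prop :=
  forall (w : lpath) (n : nat), mu (cylinder w n) =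
    (if w 0%N == s then \prod_(i < n) trans (w i) (w i.+1) else 0)%:E.

End paths.

(* A path from s is drawn from a uniform u in [0, 1[ : cut [0, 1[ into
   consecutive intervals of lengths trans s t, move to the t whose interval
   contains u, and rescale that interval to [0, 1[ for the next step.  The
   draws that follow a given word form an interval whose length is the
   product of the transition probabilities. *)
Section path_measure_existence.
Context {R : realType} {AP : countType} (M : finLMC R AP).
Implicit Types (s t : M) (u : R) (w : lpath M).

Let cum s (k : nat) : R := \sum_(v : M | (enum_rank v < k)%N) trans s v.

Let cum0 s : cum s 0 = 0.
Proof. by rewrite /cum big_pred0. Qed.

Let cumT s : cum s #|M| = 1.
Proof. by rewrite /cum -(trans_sum1 s); apply: eq_bigl => v; rewrite ltn_ord. Qed.

Let cumS s t : cum s (enum_rank t).+1 = cum s (enum_rank t) + trans s t.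
Proof.
rewrite /cum (bigD1 t) /= ?ltnSn // addrC; congr (_ + _).
apply: eq_bigl => v; rewrite ltnS ltn_neqAle andbC; congr (_ && _).
by rewrite (inj_eq val_inj) (inj_eq enum_rank_inj).
Qed.

Let cum_le s i j : (i <= j)%N -> cum s i <= cum s j.
Proof.
move=> ij; rewrite /cum big_mkcond [leRHS]big_mkcond; apply: ler_sum => v _.
case: ifPn => [vi|_]; first by rewrite (leq_trans vi ij).
by case: ifP => // _; exact: trans_ge0.
Qed.

Let inI s u t :=
  (cum s (enum_rank t) <= u) && (u < cum s (enum_rank t) + trans s t).

Let inI_cover s u : 0 <= u < 1 -> exists t, inI s u t.
Proof.
move=> /andP[u0 u1].
have ex : exists k, u < cum s k by exists #|M|; rewrite cumT.
case: (ex_minnP ex) => -[|k]; first by rewrite cum0 ltNge u0.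
move=> uk kmin.
have kM : (k < #|M|)%N by apply: kmin; rewrite cumT.
pose t : M := enum_val (Ordinal kM).
have tk : enum_rank t = k :> nat by rewrite enum_valK.
exists t; rewrite /inI -cumS tk uk andbT leNgt; apply/negP => /kmin.
by rewrite ltnn.
Qed.

Let inI_uniq s u t t' : inI s u t -> inI s u t' -> t = t'.
Proof.
suff lt_absurd a b : inI s u a -> inI s u b ->
    (enum_rank a < enum_rank b)%N -> False.
  move=> ha hb; apply/enum_rank_inj/val_inj.
  case: (ltngtP (enum_rank t) (enum_rank t')) => // h.
  - by case: (lt_absurd _ _ ha hb h).
  - by case: (lt_absurd _ _ hb ha h).
move=> /andP[_ ua] /andP[bu _] /(cum_le s); rewrite cumS => h.
by have := lt_le_trans ua (le_trans h bu); rewrite ltxx.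
Qed.

Let step s u : M := odflt s [pick t | inI s u t].

Let stepP s u t : 0 <= u < 1 -> (step s u = t) <-> inI s u t.
Proof.
move=> u01; rewrite /step; case: pickP => [t' t'I|nI] /=.
  by split=> [<-//|]; exact: inI_uniq.
by have [t' t'I] := inI_cover s u01; rewrite nI in t'I.
Qed.

Let rescale s u : R :=
  (u - cum s (enum_rank (step s u))) / trans s (step s u).

Let rescale01 s u : 0 <= u < 1 -> 0 <= rescale s u < 1.
Proof.
move=> u01; rewrite /rescale; set t := step s u.
have /andP[h1 h2] : inI s u t by apply/stepP.
have p0 : 0 < trans s t.
  by rewrite -(ltrD2l (cum s (enum_rank t))) addr0 (le_lt_trans h1).
by rewrite divr_ge0 ?subr_ge0 ?trans_ge0 //= ltr_pdivrMr // mul1r ltrBlDl.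
Qed.

Let run := fix run s u (n : nat) : M :=
  if n is n'.+1 then run (step s u) (rescale s u) n' else s.

Let draws s w n : set R :=
  [set u | 0 <= u < 1 /\ forall i, (i <= n)%N -> run s u i = w i].

Let draws_itv n s w : w 0%N = s -> exists2 a,
  0 <= a /\ a + \prod_(i < n) trans (w i) (w i.+1) <= 1 &
  draws s w n = [set u | a <= u < a + \prod_(i < n) trans (w i) (w i.+1)].
Proof.
elim: n s w => [|n IH] s w w0.
  exists 0; first by rewrite big_ord0 add0r.
  apply/seteqP; split=> u /=; rewrite big_ord0 add0r; first by case.
  by move=> u01; split=> // -[|//] _ /=.
pose w' : lpath M := fun i => w i.+1.
have [a' [a'0 a'1] E] := IH (w 1%N) w' erefl.
set t := w 1%N in E *; set c := cum s (enum_rank t).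
have pE : \prod_(i < n.+1) trans (w i) (w i.+1) =
    trans s t * \prod_(i < n) trans (w' i) (w' i.+1).
  by rewrite big_ord_recl /= w0.
rewrite pE; set p' := \prod_(i < n) trans (w' i) (w' i.+1) in a'1 E *.
have p'0 : 0 <= p' by apply: prodr_ge0 => i _; exact: trans_ge0.
have c0 : 0 <= c by rewrite -(cum0 s) cum_le.
have c1 : c + trans s t <= 1.
  by rewrite -cumS -(cumT s) cum_le // ltn_ord.
have q0 := trans_ge0 s t.
have b0 : 0 <= trans s t * a' by rewrite mulr_ge0.
have b1 : trans s t * a' + trans s t * p' <= trans s t.
  by rewrite -mulrDr ler_piMr.
exists (c + trans s t * a').
  split; first by rewrite addr_ge0.
  by rewrite -addrA; apply: le_trans c1; rewrite lerD2l.
have key u : 0 <= u < 1 -> draws s w n.+1 u <->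
    inI s u t /\ draws t w' n (rescale s u).
  move=> u01; split=> [[_ h]|[/stepP - /(_ u01) st [_ h]]].
    have st : step s u = t := h 1%N isT.
    split; first exact/stepP.
    split; first exact: rescale01.
    by move=> i ilen; rewrite -st; exact: (h i.+1).
  split=> // -[_|i ilen] //=; rewrite st; exact: h.
have affine u : inI s u t -> 0 <= u < 1 ->
    (a' <= rescale s u < a' + p') =
    (c + trans s t * a' <= u < c + trans s t * a' + trans s t * p').
  move=> /[dup] /andP[h1 h2] tI u01.
  have st : step s u = t by apply/stepP.
  have qpos : 0 < trans s t.
    by rewrite -(ltrD2l (cum s (enum_rank t))) addr0 (le_lt_trans h1).
  rewrite /rescale st -/c ler_pdivlMr // ltr_pdivrMr // lerBrDl ltrBlDl.
  by rewrite mulrDl addrA ![_ * trans s t]mulrC.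
apply/seteqP; split=> u /=.
  move=> /[dup] -[u01 _] /key -/(_ u01)[tI]; rewrite E /=.
  by rewrite affine.
move=> /andP[l r].
have tI : inI s u t.
  rewrite /inI -/c (le_trans _ l) ?lerDl //=.
  by rewrite (lt_le_trans r) // -addrA lerD2l.
have u01 : 0 <= u < 1.
  rewrite (le_trans _ l) ?addr_ge0 //=.
  by move: tI => /andP[_ h2]; rewrite (lt_le_trans h2).
by apply/key => //; split=> //; rewrite E /= affine // l r.
Qed.

Let draws0 n s w : w 0%N <> s -> draws s w n = set0.
Proof. by move=> w0; apply/seteqP; split=> u //= [_ /(_ 0%N)] /= /(_ isT)/esym. Qed.

Let unit_itv : set R := `[0, 1[.

Local Definition draw s (u : measurableTypeR R) : pathSpace M :=
  run s (if 0 <= u < 1 then u else 0).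

Let draw_cylinder s w n : draw s @^-1` cylinder w n `&` unit_itv = draws s w n.
Proof.
apply/seteqP; split=> u /=; rewrite /unit_itv /= in_itv /=.
  by move=> [h u01]; split=> // i /h; rewrite /draw u01.
by move=> [u01 h]; split=> // i /h; rewrite /draw u01.
Qed.

Let measurable_draws s w n : measurable (draws s w n).
Proof.
have [w0|/draws0 ->//] := pselect (w 0%N = s).
have [a _ ->] := draws_itv n w0.
rewrite (_ : [set _ | _] = `[a, a + \prod_(i < n) trans (w i) (w i.+1)[%classic).
  exact: measurable_itv.
by apply/seteqP; split=> u /=; rewrite in_itv.
Qed.

Let measurable_draw s : measurable_fun [set: measurableTypeR R] (draw s).
Proof.
refine (@measurability _ _ _ _ [set: measurableTypeR R] (draw s) (@cylinders R AP M) (erefl _) _).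
move=> _ [_ [w [n ->]] <-]; rewrite setTI.
rewrite -[X in measurable X](setUIDK _ unit_itv) draw_cylinder.
apply: measurableU; first exact: measurable_draws.
rewrite (_ : _ `\` _ = if `[< cylinder w n (draw s 1) >] then ~` unit_itv else set0).
  by case: ifP => // _; apply: measurableC; exact: measurable_itv.
have out u : ~ unit_itv u -> draw s u = draw s 1.
  by move=> /negP; rewrite /unit_itv /= in_itv /= /draw ltxx andbF => /negbTE ->.
case: ifPn => /asboolP h; apply/seteqP; split=> u //=.
- by case.
- by move=> uI; split=> //; move: h; rewrite -(out u).
- by move=> [hu /out uE]; apply: h; rewrite -uE; exact: hu.
Qed.

Local Definition mu01 : set (measurableTypeR R) -> \bar R :=
  mrestr (@lebesgue_measure R) (measurable_itv `[0, 1[).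

HB.instance Definition _ := Measure.on mu01.

Let mu01T : mu01 setT = 1%E.
Proof.
rewrite /mu01 /= /mrestr setTI lebesgue_measure_itv /= lte_fin ltr01.
by rewrite sube0.
Qed.

HB.instance Definition _ := Measure_isProbability.Build _ _ _ mu01 mu01T.

HB.instance Definition _ s :=
  @isMeasurableFun.Build _ _ (measurableTypeR R) (pathSpace M) (draw s) (measurable_draw s).

Lemma path_measure_exists s :
  exists mu : probability (pathSpace M) R, is_path_measure s mu.
Proof.
exists (distribution mu01 (draw s)) => w n.
transitivity (@lebesgue_measure R (draws s w n)); first by rewrite -draw_cylinder.
case: eqP => [w0|/draws0 ->]; last by rewrite measure0.
have [a _ ->] := draws_itv n w0.
set p := \prod_(i < n) _.
rewrite (_ : [set _ | _] = `[a, a + p[%classic); last first.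
  by apply/seteqP; split=> u /=; rewrite in_itv.
rewrite lebesgue_measure_itv /= lte_fin ltrDl.
case: ltP => [_|p0]; first by rewrite -EFinD addrC addKr.
by congr EFin; apply: le_anti; rewrite p0 prodr_ge0 // => i _; exact: trans_ge0.
Qed.

End path_measure_existence.

Section path_measure.
Context {R : realType} {AP : countType} (M : finLMC R AP).
Implicit Types (s : M) (E : set (pathSpace M)).

Lemma path_measure_unique s (mu nu : probability (pathSpace M) R) :
  is_path_measure s mu -> is_path_measure s nu ->
  forall E, measurable E -> mu E = nu E.
Proof.
move=> muP nuP.
pose G : set (set (pathSpace M)) := @cylinders R AP M `|` [set set0; setT].
have Gm : G `<=` measurable.
  move=> E [cE|[->|->]]; [|exact: measurable0|exact: measurableT].
  exact: sub_sigma_algebra.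
have GE : measurable `<=` <<s G >>.
  by apply: sub_sigma_algebra2 => E cE; left.
move=> E /GE; apply: (@g_sigma_algebra_measure_unique _ _ _ G Gm (fun=> setT)).
- by move=> _; right; right.
- by apply/seteqP; split=> // x _; exists 0%N.
- move=> A B [cA|[->|->]]; last 2 first.
  + by move=> _; rewrite set0I; right; left.
  + by rewrite setTI.
  move=> [cB|[->|->]]; last 2 first.
  + by rewrite setI0; right; left.
  + by rewrite setIT; left.
  have sub (w1 w2 : lpath M) m n : (m <= n)%N ->
      G (cylinder w1 m `&` cylinder w2 n).
    move=> mn; have [h|h] := pselect (forall i, (i <= m)%N -> w1 i = w2 i).
      left; exists w2, n; apply/seteqP; split=> x /=; first by case.
      by move=> xw; split=> // i im; rewrite xw ?h // (leq_trans im).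
    right; left; apply/seteqP; split=> x //= [x1 x2]; apply: h => i im.
    by rewrite -x1 // x2 // (leq_trans im).
  move: cA cB => [w1 [m ->]] [w2 [n ->]].
  case: (leqP m n) => mn; first exact: sub.
  by rewrite setIC; exact/sub/ltnW.
- move=> A [[w [n ->]]|[->|->]]; first exact: etrans (muP w n) (esym (nuP w n)).
  + by rewrite !measure0.
  + exact: etrans (probability_setT mu) (esym (probability_setT nu)).
- move=> _ /=; apply: (@le_lt_trans _ _ 1%E); last exact: ltry.
  by have/eqP := probability_setT mu; rewrite eq_le => /andP[].
Qed.

Definition path_measure s : probability (pathSpace M) R :=
  sval (cid (path_measure_exists s)).

Lemma path_measureP s : is_path_measure s (path_measure s).
Proof. exact: svalP (cid (path_measure_exists s)). Qed.

Definition Pr s E : R := fine (path_measure s E).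

Definition diamond (C : set M) : set (pathSpace M) :=
  [set x | exists k, C (x k)].

Definition until (B C : set M) : set (pathSpace M) :=
  [set x | exists k, [/\ C (x k), forall i, (i < k)%N -> ~ C (x i)
                       & forall i, (i < k)%N -> B (x i)]].

Definition labeled (a : AP) : set M := [set u | label u a].

(* Reachability in the graph of positive-probability transitions, in any
   number of steps, including none. *)
Definition reaches (u : M) (C : set M) : Prop :=
  exists2 v, connect [rel x y | 0 < trans x y] u v & C v.

Definition rel_closed (r : rel M) (A : set M) : Prop :=
  forall u v, A u -> r u v -> A v.

Definition branching_bisimulation (eps : R) (r : rel M) : Prop :=
  equivalence_rel r /\
  forall s t, r s t -> label s = label t /\
    forall A : set M, rel_closed r A ->
      `|Pr s (until [set u | r s u] A) - Pr t (until [set u | r t u] A)| <= eps.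

Definition branching_bisimilar (eps : R) s t : Prop :=
  exists2 r : rel M, branching_bisimulation eps r & r s t.

(* The number of i < k with ~~ r (x i) (x i.+1), where k is the first index
   with x k in C; i < k is expressed as x j not in C for all j <= i, so on a
   path that never visits C all class changes are counted. *)
Definition class_changes (r : rel M) (C : set M) (x : pathSpace M) : \bar R :=
  (\sum_(0 <= i <oo | `[< forall j, (j <= i)%N -> ~ C (x j) >] &&
                      ~~ r (x i) (x i.+1)) 1)%E.

End path_measure.

(* Main.v *)
(* N below is the number of class changes, E_u its expectation from u, T the set
   of g- and f-labeled states and h u = Pr_u(<> g).  Let H be the class function
   max h.  Off T, each class C is left almost surely, and h is at most the
   harmonic extension into C of the values of H outside C.  This extension is
   the mean of H under the law of the first class reached after C; between two
   states of C these laws differ by at most eps in total variation, and H takes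
   values in [0, 1], so a class change costs eps.  Summing the costs along a
   path from s gives h t - h s <= eps * E_s(N), and the same argument for 1 - h
   gives the reverse bound.  The summation is replaced by the maximum principle
   on the finite chain: every function that is subharmonic off T and
   nonpositive on T is nonpositive. *)

Require Import Defs.
From HB Require Import structures.
From mathcomp Require Import all_boot all_order all_algebra.
From mathcomp Require Import all_classical all_reals all_analysis.
From mathcomp Require Import measurable_realfun lra.
Set Implicit Arguments.
Unset Strict Implicit.
Unset Printing Implicit Defensive.
Import Order.TTheory GRing.Theory Num.Theory.
Import numFieldNormedType.Exports.
Local Open Scope classical_set_scope.
Local Open Scope ring_scope.

Lemma equivalence_rel_eq (A : Type) (r : rel A) :
  equivalence_rel r -> forall u v, r u v -> r u = r v.
Proof.
by move=> r_equiv u v uv; apply/funext => z; have [_ ->] := r_equiv u v z.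
Qed.

(** * Averages, the maximum principle and the Dirichlet problem on a finite Markov chain *)

Section finite_chain.
Context {R : realFieldType} {S : finType} (P : S -> S -> R).
Context (P_ge0 : forall u v, 0 <= P u v).
Context (P_sum1 : forall u, \sum_v P u v = 1).

Definition avg (phi : S -> R) (u : S) : R := \sum_v P u v * phi v.

Lemma avg_cst (c : R) u : avg (fun=> c) u = c.
Proof. by rewrite /avg -mulr_suml P_sum1 mul1r. Qed.

Lemma avgD phi psi u : avg (fun v => phi v + psi v) u = avg phi u + avg psi u.
Proof. by rewrite /avg -big_split; apply: eq_bigr => v _; rewrite mulrDr. Qed.

Lemma avgZ c phi u : avg (fun v => c * phi v) u = c * avg phi u.
Proof. by rewrite /avg mulr_sumr; apply: eq_bigr => v _; rewrite mulrCA. Qed.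

Lemma avgN phi u : avg (fun v => - phi v) u = - avg phi u.
Proof. by rewrite /avg -sumrN; apply: eq_bigr => v _; rewrite mulrN. Qed.

Lemma avgB phi psi u : avg (fun v => phi v - psi v) u = avg phi u - avg psi u.
Proof. by rewrite avgD avgN. Qed.

Lemma ler_avg phi psi u :
  (forall v, phi v <= psi v) -> avg phi u <= avg psi u.
Proof. by move=> le; apply: ler_sum => v _; rewrite ler_wpM2l. Qed.

Lemma eq_avg phi psi u :
  (forall v, 0 < P u v -> phi v = psi v) -> avg phi u = avg psi u.
Proof.
move=> e; apply: eq_bigr => v _.
have [/e->//|] := ltP 0 (P u v) => Pv.
have -> : P u v = 0 by apply/le_anti; rewrite Pv P_ge0.
by rewrite !mul0r.
Qed.

Definition accessible (B : pred S) : Prop :=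
  forall u, exists2 v, connect [rel x y | 0 < P x y] u v & B v.

Lemma accessibleW (B B' : pred S) :
  {subset B <= B'} -> accessible B -> accessible B'.
Proof. by move=> BB' acc u; have [v uv /BB' Bv] := acc u; exists v. Qed.

(* At a positive maximum all successors attain the maximum as well. *)
Lemma max_principle (B : pred S) (phi : S -> R) :
  accessible B -> (forall u, B u -> phi u <= 0) ->
  (forall u, ~~ B u -> phi u <= avg phi u) -> forall u, phi u <= 0.
Proof.
move=> acc phiB phisub u0.
have [m _ mmax] := @Order.TotalTheory.arg_maxP _ _ _ u0 xpredT phi isT.
have {}mmax v : phi v <= phi m := mmax v isT.
rewrite (le_trans (mmax u0)) // leNgt; apply/negP => m0.
have step u v : phi u = phi m -> 0 < P u v -> phi v = phi m.
  move=> um uv; have nB : ~~ B u.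
    by apply/negP => /phiB; rewrite um leNgt m0.
  apply/le_anti; rewrite mmax //= leNgt; apply/negP => vm.
  have := phisub _ nB; rewrite um -{1}(avg_cst (phi m) u) leNgt => /negP; apply.
  rewrite /avg (bigD1 v) //= [ltRHS](bigD1 v) //= ltr_leD //.
    by rewrite ltr_pM2l.
  by apply: ler_sum => w _; rewrite ler_wpM2l // mmax.
have [v /connectP[p pth ->] Bv] := acc m.
suff /(_ m erefl pth) e : forall u, phi u = phi m ->
    path [rel x y | 0 < P x y] u p -> phi (last u p) = phi m.
  by have := phiB _ Bv; rewrite e leNgt m0.
elim: p {pth Bv} => //= v' p IH u um /andP[/(step _ _ um)]; exact: IH.
Qed.

(** The maximum principle bounds both differences by 0. Since only differences enter the averaging
    hypothesis, it also covers two solutions of [phi = c + avg phi] with a common source [c]. *)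
Lemma harmonic_unique (B : pred S) (phi psi : S -> R) :
  accessible B -> (forall u, B u -> phi u = psi u) ->
  (forall u, ~~ B u -> phi u - psi u = avg phi u - avg psi u) -> phi =1 psi.
Proof.
move=> acc eqB eqavg u; apply/le_anti/andP; split; rewrite -subr_le0.
- apply: (max_principle (phi := fun u => phi u - psi u) acc) => v.
    by move/eqB->; rewrite subrr.
  by move/eqavg; rewrite avgB => ->.
- apply: (max_principle (phi := fun u => psi u - phi u) acc) => v.
    by move/eqB->; rewrite subrr.
  by move/eqavg; rewrite avgB; lra.
Qed.

(** Uniqueness makes the linear system injective, hence invertible, as the chain is finite. The
    solution is the expected total of [c] collected before [B] is reached. *)
Lemma dirichlet_solution (B : pred S) (c : S -> R) : accessible B ->
  exists w, (forall u, B u -> w u = 0) /\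
            (forall u, ~~ B u -> w u = c u + avg w u).
Proof.
move=> acc.
(* Row vectors act from the left, so this is the transpose of identity minus transition matrix, the
   rows of [P] at states of [B] being replaced by 0. *)
pose A : 'M[R]_#|S| := \matrix_(i, j) ((i == j)%:R -
  if B (enum_val j) then 0 else P (enum_val j) (enum_val i)).
pose fn (v : 'rV[R]_#|S|) u := v ord0 (enum_rank u).
have AE (v : 'rV_#|S|) u :
    fn (v *m A) u = fn v u - if B u then 0 else avg (fn v) u.
  rewrite /fn mxE (eq_bigr (fun i => v ord0 i * (i == enum_rank u)%:R -
    v ord0 i * if B u then 0 else P u (enum_val i))); last first.
    by move=> i _; rewrite mxE enum_rankK mulrBr.
  rewrite sumrB (bigD1 (enum_rank u)) //= eqxx mulr1 big1 ?addr0; last first.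
    by move=> i /negbTE ->; rewrite mulr0.
  congr (_ - _); case: ifP => _; first by rewrite big1 // => i _; rewrite mulr0.
  rewrite /avg (reindex enum_rank) /=; last first.
    by exists enum_val => x _; rewrite ?enum_rankK ?enum_valK.
  by apply: eq_bigr => x _; rewrite enum_rankK mulrC.
have Au : A \in unitmx.
  rewrite -row_free_unit; apply: inj_row_free => v vA.
  have fn0 u : fn v u = if B u then 0 else avg (fn v) u.
    by apply/eqP; rewrite -subr_eq0 -AE vA /fn mxE.
  have : fn v =1 (fun=> 0).
    apply: (harmonic_unique acc) => u Bu; rewrite fn0 ?Bu // (negbTE Bu).
    by rewrite avg_cst.
  move=> v0; apply/rowP => j; rewrite mxE -(enum_valK j).
  exact: v0.
pose b : 'rV[R]_#|S| := \row_j if B (enum_val j) then 0 else c (enum_val j).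
exists (fn (b *m invmx A)).
have key u : fn b u = fn (b *m invmx A) u -
    if B u then 0 else avg (fn (b *m invmx A)) u.
  by rewrite -AE mulmxKV.
split=> u Bu; have := key u; rewrite {1}/fn mxE enum_rankK.
  by rewrite Bu subr0.
by rewrite (negbTE Bu) => ->; rewrite subrK.
Qed.

(** * The law of the first class reached after leaving the class of [s] *)

Section exit_class.
Context (r : rel S) (r_equiv : equivalence_rel r) (s : S).
(** [Y A u] stands for the probability of reaching [A] from [u] through the class of [s]; only its
    boundary values and its one-step equation are assumed. *)
Context (Y : pred S -> S -> R) (acc : accessible (fun u => ~~ r s u)).

Definition class_closed (A : pred S) := forall u v, A u -> r u v -> A v.

Context (Y_out : forall A u, class_closed A -> ~~ A s -> ~~ r s u ->
  Y A u = (A u)%:R).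
Context (Y_in : forall A u, class_closed A -> ~~ A s -> r s u ->
  Y A u = avg (Y A) u).

Let rxx u : r u u. Proof. by have [-> _] := r_equiv u u u. Qed.

Let r_class u v : r u v -> r u = r v.
Proof. exact: equivalence_rel_eq. Qed.

Let rC u v : r u v = r v u.
Proof. by apply/idP/idP => /r_class e; rewrite -?e ?rxx // e rxx. Qed.

Let closed_class v : class_closed (r v).
Proof. by move=> u u' /r_class ->. Qed.

(* The harmonic extension of a class function phi into the class of s: Y (r v)
   is the law of the first class reached outside, and the division by #|r v|
   compensates for summing over states instead of classes. *)
Definition exit_mean (phi : S -> R) (u : S) : R :=
  \sum_(v | ~~ r s v) Y (r v) u * (phi v / #|r v|%:R).

(** Outside the class of [s], [Y (r v) u] is 1 exactly for [v] in the class of [u], so [#|r u|]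
    equal terms [phi u / #|r u|] remain. *)
Lemma exit_mean_out phi u : (forall v v', r v v' -> phi v = phi v') ->
  ~~ r s u -> exit_mean phi u = phi u.
Proof.
move=> phiC su; rewrite /exit_mean.
transitivity (\sum_(v in r u) phi u / #|r u|%:R).
  rewrite big_mkcond [RHS]big_mkcond; apply: eq_bigr => v _ /=.
  rewrite -!topredE /=.
  case: ifPn => sv.
    rewrite Y_out // 1?rC // rC.
    by case: ifPn => uv; rewrite ?mul0r // mul1r (r_class uv) (phiC _ _ uv).
  case: ifPn => // uv; move: sv; rewrite negbK => /r_class e.
  by move: su; rewrite e rC uv.
rewrite sumr_const -[X in X *+ _]mulr1 -mulrnAr -mulrA.
rewrite [X in _ * X](_ : _ = 1) ?mulr1 // -mulr_natl mulr1 mulVf //.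
by rewrite pnatr_eq0 -lt0n; apply/card_gt0P; exists u; exact: rxx.
Qed.

Lemma exit_mean_in phi u : r s u -> exit_mean phi u = avg (exit_mean phi) u.
Proof.
move=> su; rewrite /exit_mean /avg.
under [RHS]eq_bigr do rewrite mulr_sumr.
rewrite exchange_big /=; apply: eq_bigr => v sv.
rewrite Y_in // 1?rC // /avg mulr_suml.
by apply: eq_bigr => v' _; rewrite -mulrA.
Qed.

(** Both sides are harmonic in the class of [s] and agree outside it. *)
Lemma exit_mean_indic A : class_closed A -> ~~ A s ->
  exit_mean (fun v => (A v)%:R) =1 Y A.
Proof.
move=> cA As; apply: (harmonic_unique acc) => u.
  move=> su; rewrite exit_mean_out ?Y_out // => v v' vv'.
  congr ((nat_of_bool _)%:R); apply/idP/idP => /cA; apply=> //.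
  by rewrite rC.
by rewrite negbK => su; rewrite -exit_mean_in // -Y_in.
Qed.

Lemma exit_mean_variation (eps : R) t (phi : S -> R) :
  (forall v, 0 <= phi v <= 1) ->
  (forall A, class_closed A -> ~~ A s -> Y A t - Y A s <= eps) ->
  exit_mean phi t - exit_mean phi s <= eps.
Proof.
move=> phi01 Yeps.
(* The union of the classes that are likelier exits from [t] than from [s]. As [phi] lies in [0, 1],
   its mean changes by at most the excess mass on this set. *)
pose A v := ~~ r s v && (0 < Y (r v) t - Y (r v) s).
have cA : class_closed A.
  move=> u v /andP[su Yu] uv; rewrite /A -(r_class uv) Yu andbT.
  by apply: contra su => sv; rewrite (r_class sv) rC.
have As : ~~ A s by rewrite /A rxx.
apply: le_trans (Yeps A cA As).
rewrite -!exit_mean_indic // /exit_mean -!sumrB; apply: ler_sum => v sv.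
rewrite -!mulrBl /A sv /=.
have /andP[phi0 phi1] := phi01 v.
have inv0 : 0 <= #|r v|%:R^-1 :> R by rewrite invr_ge0.
case: ltP => [/ltW Yv|Yv]; first by rewrite ler_wpM2l // ler_wpM2r.
by rewrite mul0r mulr0 mulr_le0_ge0 // mulr_ge0.
Qed.

End exit_class.

(* With H the maximum of h on each class, it suffices that m = max (H - h - w)
   is nonpositive.  In the class of s, h is at most the harmonic extension X
   of H, and comparison with the supersolution w gives
   X s <= h s + w s + m - eps - delta; passing from X s to X t costs eps.
   Hence m <= m - delta if m is attained outside T. *)
Lemma class_oscillation (T : pred S) (r : rel S) (eps delta : R)
    (Y : S -> pred S -> S -> R) (h w : S -> R) :
  equivalence_rel r -> class_closed r T -> accessible T ->
  0 <= eps -> 0 < delta ->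
  (forall s A u, ~~ T s -> class_closed r A -> ~~ A s -> ~~ r s u ->
    Y s A u = (A u)%:R) ->
  (forall s A u, ~~ T s -> class_closed r A -> ~~ A s -> r s u ->
    Y s A u = avg (Y s A) u) ->
  (forall s t A, ~~ T s -> r s t -> class_closed r A -> ~~ A s ->
    Y s A t - Y s A s <= eps) ->
  (forall u, 0 <= h u <= 1) ->
  (forall u v, T u -> r u v -> h u = h v) ->
  (forall u, ~~ T u -> h u = avg h u) ->
  (forall u, 0 <= w u) ->
  (forall u, ~~ T u ->
    avg (fun v => eps * (~~ r u v)%:R + w v) u + delta <= w u) ->
  forall s t, r s t -> h t - h s <= w s.
Proof.
move=> r_equiv cT acc eps0 delta0 Yout Yin Yeps h01 hT hT' w0 wT.
have rxx u : r u u by have [-> _] := r_equiv u u u.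
have r_class := equivalence_rel_eq r_equiv.
(* The default 0 of the maximum is harmless because [h] is nonnegative. *)
pose H u := \big[Order.max/0]_(v | r u v) h v.
have hH u v : r u v -> h v <= H u by move=> uv; exact: le_bigmax_cond.
have HP u (x : R) : 0 <= x -> (forall v, r u v -> h v <= x) -> H u <= x.
  by move=> x0 hx; apply/bigmax_leP.
have HC u v : r u v -> H u = H v by move=> /r_class e; rewrite /H e.
have H01 u : 0 <= H u <= 1.
  have [/andP[h0 _] le1] : 0 <= h u <= 1 /\ forall v, h v <= 1.
    by split=> // v; have /andP[] := h01 v.
  by rewrite (le_trans h0 (hH _ _ (rxx u))) HP.
suff d0 u : H u - h u - w u <= 0.
  move=> s t st; rewrite -subr_le0 (le_trans _ (d0 s)) // !lerB //.
  exact: hH.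
have [s _ smax] := @Order.TotalTheory.arg_maxP _ _ _ u xpredT
  (fun u => H u - h u - w u) isT.
have [m mE] : exists m, m = H s - h s - w s by exists (H s - h s - w s).
have {}smax v : H v - h v - w v <= m by rewrite mE; exact: smax.
apply: le_trans (smax u) _.
have h0 v : 0 <= h v by have /andP[] := h01 v.
case: (boolP (T s)) => [Ts|Ts].
  rewrite mE subr_le0 (le_trans _ (w0 s)) // subr_le0 HP // => v sv.
  by rewrite (hT _ _ Ts sv).
have CT v : r s v -> ~~ T v.
  move=> sv; apply: contra Ts => Tv; apply: cT Tv _.
  by rewrite -(r_class _ _ sv).
have accC : accessible (fun v => ~~ r s v).
  apply: accessibleW acc => v Tv; apply/negP => /CT; apply/negP.
  by rewrite negbK.
pose X := exit_mean r s (Y s) H.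
have Xin v : r s v -> X v = avg X v.
  by move=> sv; apply: exit_mean_in => // A z; exact: Yin.
have Xout v : ~~ r s v -> X v = H v.
  by move=> sv; apply: exit_mean_out => // A z; exact: Yout.
(* [h - X] is harmonic in the class of [s] and equals [h - H <= 0] outside. *)
have hX v : h v <= X v.
  rewrite -subr_le0.
  apply: (max_principle (phi := fun v => h v - X v) accC) => v' sv'.
    by rewrite Xout // subr_le0 hH.
  by rewrite avgB -Xin -?hT' ?CT // -(negbK (r s v')).
(* The bonus inside the class balances the loss in [w]: [delta] per step, plus [eps] when the class
   is left. So [psi] is subharmonic there, and outside it is at most 0 by maximality of [m]. *)
pose psi v := X v - h v - w v - m + (eps + delta) * (r s v)%:R.
have /(_ s) : forall v, psi v <= 0.
  apply: (max_principle accC) => v sv.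
    by rewrite /psi Xout // (negbTE sv) mulr0 addr0 subr_le0 smax.
  rewrite negbK in sv; rewrite /psi avgD !avgB avgZ avg_cst -Xin -?hT' ?CT //.
  have := wT _ (CT _ sv).
  have -> : avg (fun v' => eps * (~~ r v v')%:R + w v') v =
      eps * (1 - avg (fun v' => (r s v')%:R) v) + avg w v.
    rewrite avgD avgZ; congr (_ * _ + _).
    rewrite -{2}(avg_cst 1 v) -avgB; apply: eq_bigr => v' _.
    by rewrite (r_class _ _ sv); case: (r v v'); rewrite ?subrr ?subr0.
  rewrite sv mulr1.
  have : 0 <= delta * avg (fun v' => (r s v')%:R) v.
    rewrite mulr_ge0 ?(ltW delta0) // -(avg_cst 0 v); exact: ler_avg.
  lra.
rewrite /psi rxx mulr1 => psis.
suff : H s <= h s + w s + m - delta by lra.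
have hyp t : r s t -> h t <= h s + w s + m - delta.
  move=> st.
  have : X t - X s <= eps.
    apply: exit_mean_variation => // [A z|A z|A]; [exact: Yout|exact: Yin|].
    exact: Yeps.
  have := hX t; lra.
by apply: HP => //; rewrite (le_trans (h0 s)) // hyp.
Qed.

End finite_chain.

(** * First-step decomposition of the path measure *)

Section path_space.
Context {R : realType} {AP : countType} (M : finLMC R AP).

Definition prefix_determined (n : nat) (E : set (pathSpace M)) : Prop :=
  forall x y, (forall i, (i <= n)%N -> x i = y i) -> E x -> E y.

(** Finitely many states give finitely many prefixes, so [E] is a finite union of cylinders. *)
Lemma measurable_prefix n E : prefix_determined n E -> measurable E.
Proof.
move=> nE.
pose w (f : {ffun 'I_n.+1 -> M}) : lpath M := fun i => f (inord i).
rewrite (_ : E = \bigcup_(f in [set f | E (w f)]) cylinder (w f) n).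
  apply: fin_bigcup_measurable; first exact: finite_finset.
  by move=> f _; apply: sub_sigma_algebra; exists (w f), n.
apply/seteqP; split=> [x Ex|x [f Ef fx]].
  have xw i : (i <= n)%N -> x i = w [ffun j : 'I_n.+1 => x j] i.
    by move=> le; rewrite /w ffunE inordK.
  exists [ffun j : 'I_n.+1 => x j]; last exact: xw.
  exact: nE xw Ex.
by apply: nE Ef => i /fx.
Qed.

Definition cons_path (s : M) (x : pathSpace M) : pathSpace M :=
  fun i => if i is j.+1 then x j else s.

Lemma measurable_cons_path s : measurable_fun setT (cons_path s).
Proof.
refine (@measurability _ _ _ _ setT (cons_path s) (@cylinders R AP M) (erefl _) _).
move=> _ [_ [w [n ->]] <-]; rewrite setTI.
apply: (@measurable_prefix n) => x y xy xw [|i] le; first exact: (xw 0%N).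
by rewrite /= -xy ?(ltnW le) //; exact: (xw i.+1).
Qed.

Lemma measurable_cons_preimage s E :
  measurable E -> measurable (cons_path s @^-1` E).
Proof. by move=> mE; rewrite -[X in measurable X]setTI; exact: measurable_cons_path. Qed.

HB.instance Definition _ s :=
  @isMeasurableFun.Build _ _ (pathSpace M) (pathSpace M) (cons_path s)
    (measurable_cons_path s).

(** The mixture, with weights [trans s t], of the path laws from [t] with [s] prepended. Building it
    from [msum], [mscale] and [distribution] makes their measure structures and integral formulas
    available. *)
Definition first_step (s : M) : set (pathSpace M) -> \bar R :=
  msum (fun k => let t := nth s (enum M) k in
    mscale (NngNum (trans_ge0 s t))
      (distribution (path_measure t) (cons_path s))) #|M|.

HB.instance Definition _ s := Measure.on (first_step s).

Let sum_enum (s : M) (F : M -> \bar R) :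
  (\sum_(k < #|M|) F (nth s (enum M) k) = \sum_t F t)%E.
Proof. by rewrite -[RHS]big_enum (big_nth s) big_mkord cardE. Qed.

Lemma first_stepE s E :
  first_step s E = (\sum_t (trans s t)%:E * path_measure t (cons_path s @^-1` E))%E.
Proof.
rewrite -(sum_enum s (fun t => _ * path_measure t _)%E).
by [].
Qed.

Let first_stepT s : first_step s setT = 1%E.
Proof.
rewrite first_stepE preimage_setT; under eq_bigr do rewrite probability_setT mule1.
by rewrite sumEFin trans_sum1.
Qed.

HB.instance Definition _ s :=
  Measure_isProbability.Build _ _ _ (first_step s) (first_stepT s).

(** By uniqueness of the path measure, agreement on cylinders identifies the mixture with
    [path_measure s]. *)
Lemma first_step_is_path_measure s : is_path_measure s (first_step s).
Proof.
move=> w n; rewrite [LHS](first_stepE s).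
case: eqP => [w0|w0]; last first.
  rewrite big1 // => t _; rewrite (_ : _ @^-1` _ = set0) ?measure0 ?mule0 //.
  by apply/seteqP; split=> x //= /(_ 0%N isT)/= /esym.
(* A cylinder of index 0 fixes only the start, so its mass is the full sum of the transition
   probabilities. *)
case: n => [|n].
  rewrite big_ord0 -(trans_sum1 s) -sumEFin; apply: eq_bigr => t _.
  rewrite (_ : _ @^-1` _ = setT) ?probability_setT ?mule1 //.
  by apply/seteqP; split=> x //= _ [|].
have cyl : cons_path s @^-1` cylinder w n.+1 = cylinder (fun i => w i.+1) n.
  apply/seteqP; split=> x /= h; first by move=> i le; exact: (h i.+1).
  by case=> [_|i le] /=; [rewrite w0|exact: h].
rewrite cyl (bigD1 (w 1%N)) //= big1 ?adde0; last first.
  by move=> t /negbTE tw; rewrite path_measureP eq_sym tw mule0.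
by rewrite path_measureP eqxx big_ord_recl /= w0 EFinM.
Qed.

Lemma path_measure_first_step s E : measurable E ->
  path_measure s E = (\sum_t (trans s t)%:E * path_measure t (cons_path s @^-1` E))%E.
Proof.
move=> mE; rewrite -[RHS](first_stepE s).
exact: (path_measure_unique (path_measureP s) (@first_step_is_path_measure s)).
Qed.

Lemma integral_first_step (s : M) (F : pathSpace M -> \bar R) :
  measurable_fun [set: pathSpace M] F -> (forall x, 0 <= F x)%E ->
  (\int[path_measure s]_x F x =
   \sum_t (trans s t)%:E * \int[path_measure t]_x F (cons_path s x))%E.
Proof.
move=> mF F0.
transitivity (\int[first_step s]_x F x)%E.
  apply: eq_measure_integral => E mE _.
  exact: (path_measure_unique (path_measureP s) (@first_step_is_path_measure s)).
rewrite ge0_integral_measure_sum //.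
rewrite -(sum_enum s (fun t => _ * \int[path_measure t]_x _)%E).
apply: eq_bigr => k _; rewrite ge0_integral_mscale //=.
by rewrite ge0_integral_pushforward.
Qed.

Lemma Pr_first_step s E : measurable E ->
  Pr s E = avg (@trans _ _ M) (fun t => Pr t (cons_path s @^-1` E)) s.
Proof.
move=> mE; rewrite /Pr path_measure_first_step //.
rewrite -[RHS]/(fine (_)%:E) -sumEFin; congr fine; apply: eq_bigr => t _.
by rewrite EFinM fineK // fin_num_measure //; exact: measurable_cons_preimage.
Qed.

Lemma Pr01 (s : M) E : measurable E -> 0 <= Pr s E <= 1.
Proof.
move=> mE; rewrite fine_ge0 ?measure_ge0 //= -lee_fin fineK ?probability_le1 //.
exact: fin_num_measure.
Qed.

Lemma Pr0 (s : M) : Pr s (set0 : set (pathSpace M)) = 0.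
Proof. by rewrite /Pr measure0. Qed.

Lemma PrT (s : M) : Pr s (setT : set (pathSpace M)) = 1.
Proof. by rewrite /Pr probability_setT. Qed.

(** After one step only the preimages under prepending [s] matter, and these coincide. *)
Lemma eq_path_measure (s : M) (E F : set (pathSpace M)) :
  measurable E -> measurable F -> (forall x, x 0%N = s -> E x <-> F x) ->
  path_measure s E = path_measure s F.
Proof.
move=> mE mF EF; rewrite !path_measure_first_step //.
apply: eq_bigr => t _; congr (_ * path_measure t _)%E.
by apply/seteqP; split=> x; apply EF.
Qed.

(** * Boundary values and one-step equations of until and reachability probabilities *)

Lemma measurable_until (B C : set M) : measurable (until B C).
Proof.
rewrite (_ : until B C = \bigcup_k [set x | [/\ C (x k),
  forall i, (i < k)%N -> ~ C (x i) & forall i, (i < k)%N -> B (x i)]]).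
  apply: bigcupT_measurable => k; apply: (@measurable_prefix k).
  move=> x y xy [Ck nC BB]; split=> [|i ik|i ik]; rewrite -xy // ?(ltnW ik) //.
  - exact: nC.
  - exact: BB.
by apply/seteqP; split=> x /= [k]; [exists k|move=> _; exists k].
Qed.

Lemma until_target (B C : set M) s : C s -> Pr s (until B C) = 1.
Proof.
move=> Cs; rewrite -(PrT s) /Pr (@eq_path_measure s (until B C) setT) //.
  exact: measurable_until.
by move=> x x0; split=> // _; exists 0%N; split=> //; rewrite x0.
Qed.

Lemma until_outside (B C : set M) s :
  ~ C s -> ~ B s -> Pr s (until B C) = 0.
Proof.
move=> Cs Bs; rewrite -(Pr0 s) /Pr (@eq_path_measure s (until B C) set0) //.
  exact: measurable_until.
move=> x x0; split=> // -[[|k] [xC _ xB]]; first by apply: Cs; rewrite -x0.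
by apply: Bs; rewrite -x0; exact: xB.
Qed.

Lemma until_step (B C : set M) s : ~ C s -> B s ->
  Pr s (until B C) = avg (@trans _ _ M) (fun t => Pr t (until B C)) s.
Proof.
move=> Cs Bs; rewrite Pr_first_step; last exact: measurable_until.
congr avg; apply/funext => t; congr (Pr t _).
apply/seteqP; split=> x.
  move=> [[|k] [xC xnC xB]] //; exists k.
  by split=> // i ik; [exact: (xnC i.+1)|exact: (xB i.+1)].
move=> [k [xC xnC xB]]; exists k.+1; split=> // -[|i] ik //.
  exact: xnC.
exact: xB.
Qed.

Lemma measurable_visit (C : set M) k :
  measurable [set x : pathSpace M | C (x k)].
Proof. by apply: (@measurable_prefix k) => x y xy /=; rewrite xy. Qed.

Lemma diamondE (C : set M) : diamond C = \bigcup_k [set x | C (x k)].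
Proof. by apply/seteqP; split=> x [k]; [exists k|move=> _; exists k]. Qed.

Lemma measurable_diamond (C : set M) : measurable (diamond C).
Proof. by rewrite diamondE; apply: bigcupT_measurable => k; exact: measurable_visit. Qed.

Lemma diamond_target (C : set M) s : C s -> Pr s (diamond C) = 1.
Proof.
move=> Cs; rewrite -(PrT s) /Pr (@eq_path_measure s (diamond C) setT) //.
  exact: measurable_diamond.
by move=> x x0; split=> // _; exists 0%N; rewrite x0.
Qed.

Lemma diamond_step (C : set M) s : ~ C s ->
  Pr s (diamond C) = avg (@trans _ _ M) (fun t => Pr t (diamond C)) s.
Proof.
move=> Cs; rewrite Pr_first_step; last exact: measurable_diamond.
congr avg; apply/funext => t; congr (Pr t _).
by apply/seteqP; split=> x; [move=> [[|k]] //; exists k|move=> [k]; exists k.+1].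
Qed.

(** Induction on [k]: a successor of positive probability cannot reach [C] either. *)
Lemma visit_unreachable (C : set M) s k : ~ reaches s C ->
  path_measure s [set x | C (x k)] = 0%E.
Proof.
elim: k s => [|k IH] s sC.
  rewrite -(measure0 (path_measure s)); apply: eq_path_measure => //.
    exact: measurable_visit.
  by move=> x x0; split=> // /=; rewrite x0 => Cs; apply: sC; exists s.
rewrite path_measure_first_step; last exact: measurable_visit.
apply: big1 => t _; have [st|st] := ltP 0 (trans s t); last first.
  by rewrite (_ : trans s t = 0) ?mul0e //; apply/le_anti; rewrite st trans_ge0.
rewrite [path_measure t _]IH ?mule0 // => -[v tv Cv]; apply: sC; exists v => //.
by apply: connect_trans tv; exact: connect1.
Qed.

Lemma diamond_unreachable (C : set M) s : ~ reaches s C -> Pr s (diamond C) = 0.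
Proof.
move=> sC; rewrite /Pr; suff -> : path_measure s (diamond C) = 0%E by [].
apply: measure_negligible; first exact: measurable_diamond.
rewrite diamondE; apply: negligible_bigcup => k; apply/negligibleP.
  exact: measurable_visit.
exact: visit_unreachable.
Qed.

(** * The number of class changes and the one-step equation of its expectation *)

Lemma class_changesE (r : rel M) (C : set M) (x : pathSpace M) :
  class_changes r C x = (\sum_(0 <= i <oo)
    (\1_[set y : pathSpace M | (forall j, (j <= i)%N -> ~ C (y j)) /\
                 ~~ r (y i) (y i.+1)] x)%:E)%E.
Proof.
rewrite /class_changes eseries_mkcond; apply: eq_eseriesr => i _.
rewrite indicE; case: ifP => [/andP[/asboolP h1 h2]|/negP h].
  by rewrite mem_set.
rewrite memNset // => -[h1 h2]; apply: h; rewrite h2 andbT; exact/asboolP.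
Qed.

Lemma measurable_change (r : rel M) (C : set M) i :
  measurable [set y : pathSpace M | (forall j, (j <= i)%N -> ~ C (y j)) /\
                                    ~~ r (y i) (y i.+1)].
Proof.
apply: (@measurable_prefix i.+1) => x y xy [h1 h2]; split; last by rewrite -!xy.
by move=> j ji; rewrite -xy ?(leq_trans ji) //; exact: h1.
Qed.

Lemma measurable_class_changes (r : rel M) (C : set M) :
  measurable_fun [set: pathSpace M] (class_changes r C).
Proof.
rewrite (funext (class_changesE r C)).
apply: (ge0_emeasurable_sum (P := xpredT) (h := fun i x => (\1_[set y : pathSpace M |
  (forall j, (j <= i)%N -> ~ C (y j)) /\ ~~ r (y i) (y i.+1)] x)%:E)) => // i _.
apply/measurable_EFinP/measurable_indic; exact: measurable_change.
Qed.

Lemma class_changes_ge0 (r : rel M) (C : set M) x : (0 <= class_changes r C x)%E.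
Proof. by rewrite class_changesE; apply: nneseries_ge0 => i _ _; rewrite lee_fin. Qed.

(** Term 0 records the change in the step out of [s]. The later terms are those of [x] shifted by
    one, their extra condition at index 0 being [~ C s]. *)
Lemma class_changes_cons (r : rel M) (C : set M) s x : ~ C s ->
  class_changes r C (cons_path s x) =
  ((\1_[set y : pathSpace M | ~~ r s (y 0%N)] x)%:E + class_changes r C x)%E.
Proof.
move=> Cs; rewrite !class_changesE nneseries_recl //.
congr (_ + _)%E.
  rewrite !indicE; congr ((nat_of_bool _)%:R%:E).
  apply/idP/idP; rewrite !inE; first by case.
  by move=> h; split=> // j; rewrite leqn0 => /eqP ->.
rewrite -nneseries_addn //; apply: eq_eseriesr => i _.
rewrite addn1 !indicE; congr ((nat_of_bool _)%:R%:E).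
apply/idP/idP; rewrite !inE => -[nC nr]; split=> // j ji.
  exact: (nC j.+1).
by case: j ji => //= j; rewrite ltnS; exact: nC.
Qed.

Definition expected_changes (r : rel M) (C : set M) (s : M) : \bar R :=
  (\int[path_measure s]_x class_changes r C x)%E.

Lemma expected_changes_ge0 (r : rel M) (C : set M) s :
  (0 <= expected_changes r C s)%E.
Proof. by apply: integral_ge0 => x _; exact: class_changes_ge0. Qed.

Lemma expected_changes_step (r : rel M) (C : set M) s : ~ C s ->
  expected_changes r C s = (\sum_t (trans s t)%:E *
    ((~~ r s t)%:R%:E + expected_changes r C t))%E.
Proof.
move=> Cs; rewrite /expected_changes integral_first_step; last 2 first.
- exact: measurable_class_changes.
- exact: class_changes_ge0.
apply: eq_bigr => t _; congr (_ * _)%E.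
have mr : measurable [set y : pathSpace M | ~~ r s (y 0%N)].
  exact: (measurable_visit [set u | ~~ r s u]).
under eq_integral do rewrite class_changes_cons //.
rewrite ge0_integralD //; last 3 first.
- exact/measurable_EFinP/measurable_indic.
- by move=> x _; exact: class_changes_ge0.
- exact: measurable_class_changes.
congr (_ + _)%E; rewrite integral_indic // setIT.
case: (boolP (r s t)) => rst /=.
  transitivity (path_measure t set0); last by rewrite measure0.
  by apply: eq_path_measure => // x x0; split=> //=; rewrite x0 rst.
transitivity (path_measure t setT); last by rewrite probability_setT.
by apply: eq_path_measure => // x x0; split=> //=; rewrite x0.
Qed.

End path_space.

(** * Comparing the Dirichlet solution with the expected number of class changes *)

Section expected_changes_bound.
Context {R : realType} {AP : countType} (M : finLMC R AP).
Local Notation mean := (avg (@trans _ _ M)).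

(* The maximum principle for w - E, with the states of infinite expectation E
   added to the boundary. *)
Lemma expected_changes_ge (r : rel M) (C : set M) (w : M -> R) :
  accessible (@trans _ _ M) (fun u => `[< C u >]) ->
  (forall u, C u -> w u = 0) ->
  (forall u, ~ C u -> w u = mean (fun v => (~~ r u v)%:R) u + mean w u) ->
  forall u, ((w u)%:E <= expected_changes r C u)%E.
Proof.
move=> acc wC wnC u0.
pose E := expected_changes r C.
have E0 u : (0 <= E u)%E by exact: expected_changes_ge0.
(* The default 0 satisfies the boundary condition at states of infinite expectation, where the claim
   is trivial. *)
pose phi u := if E u \is a fin_num then w u - fine (E u) else 0.
suff phi0 u : phi u <= 0.
  have := phi0 u0; rewrite /phi -/(E u0).
  case: ifPn => [fE|]; first by rewrite subr_le0 -lee_fin fineK.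
  by rewrite ge0_fin_numE // -leNgt leye_eq => /eqP -> _; rewrite leey.
pose B u := `[< C u >] || (E u \isn't a fin_num).
apply: (max_principle (@trans_ge0 _ _ M) (@trans_sum1 _ _ M) (B := B)).
- by apply: accessibleW acc => v; rewrite /B -!topredE /= => ->.
- move=> v; rewrite /phi; case: ifPn => // fE.
  rewrite /B fE orbF => /asboolP Cv.
  by rewrite wC // sub0r oppr_le0 fine_ge0.
move=> v; rewrite /B negb_or negbK => /andP[/asboolP Cv fE].
have EE := expected_changes_step r Cv; rewrite -/E in EE.
have term0 t : (0 <= (trans v t)%:E * ((~~ r v t)%:R%:E + E t))%E.
  by rewrite mule_ge0 ?lee_fin ?trans_ge0 // adde_ge0 // lee_fin.
(* Finiteness passes to successors of positive probability, so the default value of [phi] never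
   enters the average with positive weight. *)
have fin t : 0 < trans v t -> E t \is a fin_num.
  move=> vt; rewrite ge0_fin_numE // ltNge leye_eq; apply/negP => /eqP Et.
  move: fE; rewrite ge0_fin_numE // EE ltNge leye_eq => /negP; apply.
  rewrite (bigD1 t) //= Et addey // gt0_muley ?lte_fin // addye //.
  by rewrite gt_eqF // (lt_le_trans _ (sume_ge0 _ _)) ?ltNyr.
have Ev : fine (E v) = mean (fun t => (~~ r v t)%:R + fine (E t)) v.
  rewrite EE -[RHS]/(fine (_)%:E) -sumEFin; congr fine; apply: eq_bigr => t _.
  have [vt|vt] := ltP 0 (trans v t).
    by rewrite [in RHS]EFinM EFinD fineK ?fin.
  by rewrite (_ : trans v t = 0) ?mul0e ?mul0r //; apply/le_anti; rewrite vt trans_ge0.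
rewrite {1}/phi fE Ev wnC // avgD [leLHS](_ : _ = mean (fun t => w t - fine (E t)) v).
  rewrite le_eqVlt; apply/orP; left; apply/eqP.
  by apply: eq_avg => [|t /fin ft]; [exact: trans_ge0|rewrite /phi ft].
by rewrite avgB; lra.
Qed.

End expected_changes_bound.

(** * Reachability probabilities of bisimilar states *)

Theorem corollary5p9 (R : realType) (AP : countType) (g f : AP) (gf : g != f)
  (eps : R) (eps01 : 0 <= eps <= 1) (M : finLMC R AP)
  (some_g : exists u : M, label u g)
  (exactly_f : forall u : M, label u f <-> ~ reaches u (labeled g))
  (s t : M) (st : branching_bisimilar eps s t)
  (r : rel M) (r_bisim : branching_bisimulation eps r) (rst : r s t) :
  (`|Pr s (diamond (labeled g)) - Pr t (diamond (labeled g))|%:E <=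
   eps%:E * \int[path_measure s]_x
     class_changes r (labeled g `|` labeled f) x)%E.
Proof.
have [r_equiv rP] := r_bisim; have /andP[eps0 _] := eps01.
have rxx u : r u u by have [-> _] := r_equiv u u u.
have r_class := equivalence_rel_eq r_equiv.
set C := labeled g `|` labeled f.
pose T u := `[< C u >].
have acc : accessible (@trans _ _ M) T.
  move=> u; have [[v uv gv]|nu] := pselect (reaches u (labeled g)).
    by exists v => //; apply/asboolP; left.
  by exists u => //; apply/asboolP; right; exact/exactly_f.
have lab u v a : r u v -> label u a -> label v a by move=> /rP[->].
have cT : class_closed r T.
  by move=> u v /asboolP[?|?] uv; apply/asboolP; [left|right]; apply: lab uv _.
have mean1 := avg_cst (@trans_sum1 _ _ M).
pose c u := avg (@trans _ _ M) (fun v => (~~ r u v)%:R) u.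
(* [w] is a finite stand-in for the expected number of changes, with source [c u] the probability of
   leaving the class of [u] in one step. [tau] below plays the role of the expected time to reach
   [T]; it decreases by 1 per step on average. *)
have [w [w0 wS]] := dirichlet_solution (@trans_ge0 _ _ M) (@trans_sum1 _ _ M) c acc.
have [tau [tau0 tauS]] :=
  dirichlet_solution (@trans_ge0 _ _ M) (@trans_sum1 _ _ M) (fun=> 1) acc.
have nonneg (b z : M -> R) : (forall u, 0 <= b u) -> (forall u, T u -> z u = 0) ->
    (forall u, ~~ T u -> z u = b u + avg (@trans _ _ M) z u) -> forall u, 0 <= z u.
  move=> b0 z0 zS u; rewrite -oppr_le0.
  apply: (max_principle (@trans_ge0 _ _ M) (@trans_sum1 _ _ M)
    (phi := fun u => - z u) acc) => v Tv; first by rewrite z0 ?oppr0.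
  by rewrite avgN lerN2 [leRHS]zS // lerDr.
have c0 u : 0 <= c u.
  by rewrite -(mean1 0 u); apply: ler_avg => v; [exact: trans_ge0|].
have w_ge0 := nonneg _ _ c0 w0 wS.
have tau_ge0 := nonneg _ _ (fun=> ler01) tau0 tauS.
pose Y (x : M) (A : pred M) u := Pr u (until [set v | r x v] [set v | A v]).
have osc (h : M -> R) : (forall u, 0 <= h u <= 1) ->
    (forall u v, T u -> r u v -> h u = h v) ->
    (forall u, ~~ T u -> h u = avg (@trans _ _ M) h u) ->
    h t - h s <= eps * w s.
  move=> h01 hT hS; apply/ler_addgt0Pr => e e0.
  (* Adding [delta * tau] to [eps * w] yields the strict decrease [delta] at a cost of at most [e]
     in [s]. The summand 1 keeps the denominator positive when [tau s = 0]. *)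
  pose delta := e / (1 + tau s).
  have tau1 : 0 < 1 + tau s by rewrite ltr_pwDl.
  have delta0 : 0 < delta by rewrite divr_gt0.
  apply: (@le_trans _ _ (eps * w s + delta * tau s)); last first.
    rewrite lerD2l /delta mulrAC ler_pdivrMr // ler_pM2l //; lra.
  apply: (class_oscillation (@trans_ge0 _ _ M) (@trans_sum1 _ _ M) (Y := Y)
    (w := fun u => eps * w u + delta * tau u) r_equiv cT acc eps0 delta0) => //.
  - move=> x A u _ cA _ xu; rewrite /Y; case: (boolP (A u)) => Au.
      by rewrite until_target.
    by rewrite until_outside //; exact/negP.
  - move=> x A u _ cA Ax xu; rewrite /Y until_step // => Au.
    by move/negP: Ax; apply; apply: cA Au _; rewrite -(r_class _ _ xu).
  - move=> x y A _ xy cA _.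
    have [_ /(_ [set v | A v] cA)] := rP _ _ xy.
    rewrite -(r_class _ _ xy) distrC; exact/le_trans/ler_norm.
  - by move=> u; rewrite addr_ge0 // mulr_ge0 // ltW.
  - move=> u Tu; rewrite !avgD !avgZ [in leRHS]wS // [in leRHS]tauS // /c.
    lra.
pose h (u : M) := Pr u (diamond (labeled g)).
have h01 u : 0 <= h u <= 1 by apply: Pr01; exact: measurable_diamond.
have hg u : label u g -> h u = 1 by move=> ug; exact: diamond_target.
have hf u : label u f -> h u = 0.
  by move=> /exactly_f uf; exact: diamond_unreachable.
have hT u v : T u -> r u v -> h u = h v.
  move=> /asboolP[ug|uf] uv; first by rewrite !hg //; exact: lab uv _.
  by rewrite !hf //; exact: lab uv _.
have hS u : ~~ T u -> h u = avg (@trans _ _ M) h u.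
  by move=> /asboolP nC; apply: diamond_step => ug; apply: nC; left.
have le1 := osc h h01 hT hS.
(* Using [1 - h] instead of exchanging [s] and [t] keeps the bound in terms of [w s]. *)
have le2 : (1 - h t) - (1 - h s) <= eps * w s.
  apply: (osc (fun u => 1 - h u)).
  - by move=> u; have := h01 u; lra.
  - by move=> u v Tu uv; rewrite (hT _ _ Tu uv).
  - by move=> u Tu; rewrite avgB mean1 -hS.
apply: (@le_trans _ _ (eps * w s)%:E).
  rewrite lee_fin -/(h s) -/(h t) ler_norml; lra.
rewrite EFinM lee_wpmul2l ?lee_fin //.
apply: expected_changes_ge => // u.
- by move=> Cu; apply: w0; exact/asboolP.
- by move=> nCu; apply: wS; exact/asboolPn.
Qed.
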